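(* Let $X$ be a separable Banach space. For any $X$-valued martingale $(f_n : 0\leq n\leq N)$ on a probability space $(\Omega,\mathcal{F},\mathbb{P})$ with respect to a filtration $(\mathcal{F}_n : 0\leq n\leq N)$, and any $\varepsilon > 0$, there exists a filtration $(\mathcal{G}_n : 0\leq n\leq N)$ such that each $\mathcal{G}_n$ is atomic, $\mathcal{G}_n\subset \mathcal{F}_n$, and $$\left\|f_n-\mathbb{E}\left(f_N\mid \mathcal{G}_n\right)\right\|<\varepsilon \quad\text{almost surely, for all } 0\leq n\leq N.$$
   Context: A filtration is an increasing sequence of sub-$\sigma$-fields of $\mathcal{F}$. A sequence of (Bochner) integrable $X$-valued random variables $(f_n)$ is a martingale with respect to $(\mathcal{F}_n)$ if $\mathbb{E}(f_m\mid\mathcal{F}_n)=f_n$ for all $m\ge n$. A $\sigma$-field is atomic if it is generated by an at most countable measurable partition of $\Omega$. The norm $\|\cdot\|$ is the norm of $X$, evaluated pointwise on $\Omega$. *)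

(* Defs.v *)
From HB Require Import structures.
From mathcomp Require Import all_boot all_order all_algebra.
From mathcomp Require Import all_classical all_reals all_analysis.

Set Implicit Arguments.
Unset Strict Implicit.
Unset Printing Implicit Defensive.

Import Order.TTheory GRing.Theory Num.Theory.
Import numFieldNormedType.Exports.

Local Open Scope classical_set_scope.
Local Open Scope ring_scope.

Definition separable (X : topologicalType) : Prop :=
  exists D : set X, countable D /\ dense D.

Definition sub_sigma_field (d : measure_display) (T : measurableType d)
    (G : set (set T)) : Prop :=
  sigma_algebra setT G /\ G `<=` d.-measurable.

Definition filtration (d : measure_display) (T : measurableType d) (N : nat)
    (F : 'I_N.+1 -> set (set T)) : Prop :=
  (forall n, sub_sigma_field (F n)) /\
  (forall n m : 'I_N.+1, (n <= m)%N -> F n `<=` F m).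

Definition atomic (d : measure_display) (T : measurableType d)
    (G : set (set T)) : Prop :=
  exists C : set (set T),
    [/\ countable C, C `<=` d.-measurable, partition C id setT & G = <<s C >>].

(* Measurability from (T, G) to X with its Borel sigma-field <<s open >>. *)
Definition borel_measurable (T : Type) (X : topologicalType)
    (G : set (set T)) (f : T -> X) : Prop :=
  forall B : set X, <<s (@open X) >> B -> G (f @^-1` B).

(* The library's {sfun _ >-> _} and its Lebesgue integral only handle
   real-valued functions; what follows is the Bochner integral for functions
   with values in a real normed space X. *)
Section Bochner.
Context (d : measure_display) (T : measurableType d) (R : realType).
Context (X : completeNormedModType R) (P : probability T R).

Definition simple_function (s : T -> X) : Prop :=
  finite_set (range s) /\ forall x : X, measurable (s @^-1` [set x]).

Definition simple_integral (A : set T) (s : T -> X) : X :=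
  \sum_(x \in range s) fine (P (A `&` s @^-1` [set x])) *: x.

Definition bochner_approx (f : T -> X) (s : nat -> T -> X) : Prop :=
  (forall k, simple_function (s k)) /\
  (\int[P]_w (`|f w - s k w|)%:E)%E @[k --> \oo] --> 0%E.

(* Borel measurability and the usual strong measurability are the same when X
   is separable, the only case in which this is used. *)
Definition bochner_integrable (f : T -> X) : Prop :=
  borel_measurable d.-measurable f /\ exists s, bochner_approx f s.

(* For f integrable and A measurable, the limit exists by completeness of X
   and does not depend on the approximating sequence s. *)
Definition bochner_integral (A : set T) (f : T -> X) : X :=
  get [set v : X | exists2 s, bochner_approx f s &
                     simple_integral A (s k) @[k --> \oo] --> v].

(* g is a version of E(f | G); versions are unique only up to P-null sets. *)
Definition is_condexp (G : set (set T)) (f g : T -> X) : Prop :=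
  [/\ borel_measurable G g, bochner_integrable g &
      forall A, G A -> bochner_integral A g = bochner_integral A f].

(* E(f m | F n) = f n is an almost sure equality: f n need not itself be
   F n-measurable, only almost surely equal to a version. *)
Definition martingale (N : nat) (F : 'I_N.+1 -> set (set T))
    (f : 'I_N.+1 -> T -> X) : Prop :=
  (forall n, bochner_integrable (f n)) /\
  (forall n m : 'I_N.+1, (n <= m)%N ->
     exists2 g, is_condexp (F n) (f m) g & {ae P, forall w, g w = f n w}).

End Bochner.

(* Main.v *)
(* Choose an F_n-measurable version h_n of f_n, a countable Borel partition of X
   into pieces of diameter < eps, and let G_n be generated by the partition of
   Omega recording in which pieces h_0, ..., h_n lie. These partitions refine one
   another, so (G_n) is a filtration, and G_n is contained in F_n because F is
   increasing. Hence f_N and h_n have the same integral over each atom of G_n, and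
   on an atom A of positive probability E(f_N | G_n) is the average of h_n over A,
   which is within the oscillation of h_n on A, hence within eps, of h_n. *)

Require Import Defs.
From HB Require Import structures.
From mathcomp Require Import all_boot all_order all_algebra.
From mathcomp Require Import all_classical all_reals all_analysis.
From mathcomp Require Import measurable_realfun.
Import Order.TTheory GRing.Theory Num.Theory.
Import numFieldNormedType.Exports.
Local Open Scope classical_set_scope.
Local Open Scope ring_scope.

Set Implicit Arguments.
Unset Strict Implicit.
Unset Printing Implicit Defensive.

(** * Functions with finite range *)

Section FiniteRange.
Context (d : measure_display) (T : measurableType d) (R : realType).
Context (P : probability T R).

Lemma fine_probability_fin_bigcup (I : choiceType) (D : set I) (F : I -> set T) :
  finite_set D -> trivIset D F -> (forall i, D i -> measurable (F i)) ->
  fine (P (\bigcup_(i in D) F i)) = \sum_(i \in D) fine (P (F i)).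
Proof.
move=> finD tF mF; rewrite measure_fin_bigcup//.
apply: EFin_inj; rewrite -fsumEFin// fineK.
  by apply: eq_fsbigr => i /set_mem Di; rewrite fineK// fin_num_measure//; exact: mF.
by rewrite -measure_fin_bigcup// fin_num_measure//; apply: fin_bigcup_measurable.
Qed.

Context (Y : choiceType) (t : T -> Y).
Context (fint : finite_set (range t)).
Context (mt : forall y, measurable (t @^-1` [set y])).

Lemma measurable_preimage_finite_range (S : set Y) : measurable (t @^-1` S).
Proof.
have -> : t @^-1` S = \bigcup_(y in range t `&` S) t @^-1` [set y].
  apply/seteqP; split => [w Sw|w [y [_ Sy]] /= -> //].
  by exists (t w) => //; split => //; exists w.
by apply: fin_bigcup_measurable => //; exact: finite_setIl.
Qed.

Lemma integral_comp_finite_range (A : set T) (g : Y -> R) :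
  measurable A -> (forall y, 0 <= g y) ->
  (\int[P]_(w in A) (g (t w))%:E)%E =
  (\sum_(y \in range t) fine (P (A `&` t @^-1` [set y])) * g y)%:E.
Proof.
move=> mA g0.
have mAt y : measurable (A `&` t @^-1` [set y]) by exact: measurableI.
have EA : A = \big[setU/set0]_(y <- finmap.enum_fset (fset_set (range t))) (A `&` t @^-1` [set y]).
  rewrite -bigcup_seq; apply/seteqP; split => [w Aw|w [y _ []//]].
  exists (t w) => //=; rewrite in_fset_set//; apply/mem_set; exists w => //.
rewrite {1}EA ge0_integral_bigsetU//.
- rewrite -fsumEFin// fsbig_finite//; apply: eq_bigr => y _.
  rewrite (eq_integral (cst (g y)%:E)); last by move=> w /set_mem[_ /= ->].
  by rewrite integral_cst// EFinM fineK ?fin_num_measure// muleC.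
- by move=> y z _ _ [w [[_ /= <-] [_ /= <-]]].
- move=> _ B mB; apply: measurableI; first by rewrite -EA.
  exact: (measurable_preimage_finite_range [set y | B (g y)%:E]).
- by move=> w _; rewrite lee_fin.
Qed.

End FiniteRange.

(** * Integrals of simple functions *)

Section SimpleIntegral.
Context (d : measure_display) (T : measurableType d) (R : realType).
Context (X : completeNormedModType R) (P : probability T R).
Implicit Types (A B : set T) (s : T -> X).

(** Each level set of [h \o t] splits into the fibers of [t] over it, and the two finite sums are
    exchanged. Taking for [t] a pair of simple functions puts both integrals over one common
    partition. *)
Lemma simple_integral_comp (Y : choiceType) (t : T -> Y) (h : Y -> X) A :
  finite_set (range t) -> (forall y, measurable (t @^-1` [set y])) ->
  measurable A ->
  simple_integral P A (h \o t) =
  \sum_(y \in range t) fine (P (A `&` t @^-1` [set y])) *: h y.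
Proof.
move=> fint mt mA.
have finht : finite_set (range (h \o t)) by rewrite -(image_comp t h); apply: finite_image.
rewrite /simple_integral.
transitivity (\sum_(x \in range (h \o t)) \sum_(y \in range t)
   if h y == x then fine (P (A `&` t @^-1` [set y])) *: h y else 0).
  apply: eq_fsbigr => x _.
  have -> : A `&` (h \o t) @^-1` [set x] =
     \bigcup_(y in range t `&` h @^-1` [set x]) (A `&` t @^-1` [set y]).
    apply/seteqP; split => [w [Aw /= hw]|w [y [_ /= hy]] [Aw /= tw]].
      by exists (t w) => //; split => //; exists w.
    by split => //=; rewrite tw.
  rewrite fine_probability_fin_bigcup//.
  - rewrite fsbig_mkcondr !fsbig_finite// scaler_suml; apply: eq_bigr => y _.
    case: eqVneq => [hy|/eqP hy]; first by rewrite mem_set// hy.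
    by rewrite memNset// scale0r.
  - exact: finite_setIl.
  - by move=> y z _ _ [w [[_ /= <-] [_ /= <-]]].
  - by move=> y _; apply: measurableI.
rewrite exchange_fsbig//.
apply: eq_fsbigr => y /set_mem[w _ <-].
rewrite fsbig_finite// (bigD1_seq (h (t w))) ?finmap.fset_uniq//=; last first.
  by rewrite in_fset_set//; apply/mem_set; exists w.
by rewrite eqxx big1 ?addr0// => x; rewrite eq_sym => /negbTE ->.
Qed.


Lemma simple_function_pair s s' : simple_function s -> simple_function s' ->
  finite_set (range (fun w => (s w, s' w))) /\
  forall y, measurable ((fun w => (s w, s' w)) @^-1` [set y]).
Proof.
move=> [fs ms] [fs' ms']; split.
  apply: (@sub_finite_set _ _ (range s `*` range s')); last exact: finite_setX.
  by move=> _ [w _ <-]; split; exists w.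
move=> [x x'].
rewrite (_ : _ @^-1` _ = s @^-1` [set x] `&` s' @^-1` [set x']).
  exact: measurableI.
by apply/seteqP; split => w /= [-> ->].
Qed.

(** Over the joint values of [(s, s')] the two integrals become sums with the same weights, so the
    triangle inequality applies term by term. *)
Lemma simple_integral_dist A s s' :
  simple_function s -> simple_function s' -> measurable A ->
  ((`|simple_integral P A s - simple_integral P A s'|)%:E <=
   \int[P]_(w in A) (`|s w - s' w|)%:E)%E.
Proof.
move=> ss ss' mA; have [fp mp] := simple_function_pair ss ss'.
rewrite (simple_integral_comp fst fp mp mA) (simple_integral_comp snd fp mp mA).
rewrite (@integral_comp_finite_range _ _ _ P _ _ fp mp A
  (fun y => `|y.1 - y.2|))// lee_fin.
rewrite !fsbig_finite// -sumrB; apply: le_trans (ler_norm_sum _ _ _) _.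
apply: ler_sum => y _; rewrite -scalerBr normrZ ger0_norm//.
exact: fine_ge0.
Qed.

Lemma simple_integralU A B s : simple_function s -> measurable A ->
  measurable B -> [disjoint A & B] ->
  simple_integral P (A `|` B) s = simple_integral P A s + simple_integral P B s.
Proof.
move=> [fs ms] mA mB AB; rewrite /simple_integral !fsbig_finite//.
rewrite -big_split; apply: eq_bigr => x _ /=.
rewrite setIUl measureU//; try exact: measurableI.
  by rewrite fineD ?fin_num_measure ?scalerDl//; apply: measurableI.
by rewrite setIACA (disj_set2P AB) set0I.
Qed.

End SimpleIntegral.

(** * The Bochner integral *)

Section BochnerIntegral.
Context (d : measure_display) (T : measurableType d) (R : realType).
Context (X : completeNormedModType R) (P : probability T R).
Implicit Types (A B : set T) (f : T -> X).

Lemma simple_function_borel (s : T -> X) :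
  simple_function s -> borel_measurable d.-measurable s.
Proof. by move=> [fs ms] B _; exact: measurable_preimage_finite_range. Qed.

(** The set where [|f - s| < a] is the finite union, over the values [x] of [s], of the sets where
    [s] is [x] and [f] lies in the open ball of radius [a] around [x]. Only preimages of open sets
    under [f] itself occur. *)
Lemma measurable_norm_sub f (s : T -> X) :
  borel_measurable d.-measurable f -> simple_function s ->
  measurable_fun setT (fun w => (`|f w - s w|)%:E).
Proof.
move=> mf [fs ms]; apply/measurable_EFinP.
apply: (measurability _ (RGenInftyO.measurableE R)) => _ [_ [a ->] <-].
rewrite setTI (_ : _ @^-1` _ = \bigcup_(x in range s)
    (s @^-1` [set x] `&` f @^-1` ball x a)).
  apply: fin_bigcup_measurable => // x _; apply: measurableI => //.
  by apply: mf; apply: sub_sigma_algebra; exact: ball_open.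
apply/seteqP; split => [w|w [_ [v _ <-] [/= <-]]].
  rewrite /= in_itv/= => fsa; exists (s w); first by exists w.
  by split => //=; rewrite -ball_normE /ball_/= distrC.
by rewrite -ball_normE /ball_/= in_itv/= distrC.
Qed.

(* A constant bound on |f - f'| is all that is needed, and it spares the
   measurability of |f - f'|. *)
Lemma simple_integral_approx_dist f f' (s s' : T -> X) A (e : R) :
  borel_measurable d.-measurable f -> borel_measurable d.-measurable f' ->
  simple_function s -> simple_function s' -> measurable A -> 0 <= e ->
  (forall w, A w -> `|f w - f' w| <= e) ->
  ((`|simple_integral P A s - simple_integral P A s'|)%:E <=
   \int[P]_w (`|f w - s w|)%:E + \int[P]_w (`|f' w - s' w|)%:E + e%:E * P A)%E.
Proof.
move=> mf mf' ss ss' mA e0 ff'.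
have mfs := measurable_norm_sub mf ss; have mfs' := measurable_norm_sub mf' ss'.
have mss' := measurable_norm_sub (simple_function_borel ss) ss'.
have mfsA : measurable_fun A (fun w => (`|f w - s w|)%:E).
  exact: measurable_funS mfs.
have mfsA' : measurable_fun A (fun w => (`|f' w - s' w|)%:E).
  exact: measurable_funS mfs'.
apply: le_trans (simple_integral_dist P ss ss' mA) _.
apply: (@le_trans _ _ (\int[P]_(w in A) ((`|f w - s w|)%:E +
   (`|f' w - s' w|)%:E + (cst e%:E w)))%E).
  apply: ge0_le_integral => //.
  - exact: measurable_funS mss'.
  - by apply: emeasurable_funD => //; exact: emeasurable_funD.
  - move=> w Aw; rewrite -!EFinD lee_fin.
    have -> : s w - s' w = (s w - f w) + (f w - f' w) + (f' w - s' w).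
      by rewrite !addrA !subrK.
    apply: le_trans (ler_normD _ _) _.
    apply: le_trans (lerD (ler_normD _ _) (lexx _)) _.
    by rewrite (distrC (s w)) -!addrA lerD2l addrC lerD2l; exact: ff'.
rewrite ge0_integralD//; last 2 first.
  - by move=> w _; apply: adde_ge0; rewrite lee_fin.
  - exact: emeasurable_funD.
rewrite ge0_integralD// integral_cst// leeD// leeD//.
- exact: ge0_subset_integral.
- exact: ge0_subset_integral.
Qed.

(** The integrals form a Cauchy sequence: [simple_integral_approx_dist] with [f' = f] and [e = 0]
    bounds their differences by two approximation errors. *)
Lemma simple_integral_is_cvg f s A :
  borel_measurable d.-measurable f -> bochner_approx P f s -> measurable A ->
  cvg (simple_integral P A (s k) @[k --> \oo]).
Proof.
move=> mf [ss s0] mA; apply/cauchy_cvgP/cauchy_exP => e e0.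
have /fine_cvgP[sfin /cvgr_lt/(_ (e / 2)) s0'] := s0.
have se : \forall k \near \oo, (\int[P]_w (`|f w - s k w|)%:E < (e / 2)%:E)%E.
  near=> k; rewrite -[ltLHS]fineK; last by near: k.
  by rewrite lte_fin; near: k; apply: s0'; rewrite divr_gt0.
have [K _ seK] := se.
exists (simple_integral P A (s K)); exists K => //= k Kk.
rewrite -ball_normE /ball_/= -lte_fin.
apply: le_lt_trans (@simple_integral_approx_dist f f _ _ _ 0 mf mf (ss K) (ss k) mA _ _) _ => //.
  by move=> w _; rewrite subrr normr0.
by rewrite mul0e adde0 [e in ltRHS]splitr EFinD lteD//; apply: seK => /=.
Unshelve. all: by end_near. Qed.

(** The limit of [simple_integral_approx_dist]. With [f' = f] and [e = 0] it shows that the limit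
    does not depend on the approximating sequence; with general [e] it is the basic estimate for the
    Bochner integral. *)
Lemma bochner_limit_dist f f' s s' A (e : R) (v v' : X) :
  borel_measurable d.-measurable f -> borel_measurable d.-measurable f' ->
  bochner_approx P f s -> bochner_approx P f' s' ->
  measurable A -> 0 <= e -> (forall w, A w -> `|f w - f' w| <= e) ->
  simple_integral P A (s k) @[k --> \oo] --> v ->
  simple_integral P A (s' k) @[k --> \oo] --> v' ->
  `|v - v'| <= e * fine (P A).
Proof.
move=> mf mf' [ss s0] [ss' s0'] mA e0 ff' sv sv'.
(* The bound is rewritten as [0 + 0 + e * P A], the termwise limit of the right-hand sides. *)
rewrite -lee_fin EFinM fineK ?fin_num_measure// -[leRHS]add0e.
rewrite -[X in (_ <= X + _)%E](adde0 0%E).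
apply: (lee_cvg_to (a := \oo)
  (f := fun k =>
     (`|simple_integral P A (s k) - simple_integral P A (s' k)|)%:E)
  (g := fun k => \int[P]_w (`|f w - s k w|)%:E +
     \int[P]_w (`|f' w - s' k w|)%:E + e%:E * P A)%E).
- apply/fine_cvgP; split; [by apply: nearW|by apply: cvg_norm; exact: cvgB].
- apply: cvgeD; [|apply: cvgeD => //|exact: cvg_cst].
  by rewrite adde0 fin_num_adde_defr.
- by apply: nearW => k; exact: simple_integral_approx_dist.
Qed.

Lemma bochner_integral_cvg f s A :
  borel_measurable d.-measurable f -> bochner_approx P f s -> measurable A ->
  simple_integral P A (s k) @[k --> \oo] --> bochner_integral P A f.
Proof.
move=> mf sf mA; have /cvg_ex[v sv] := simple_integral_is_cvg mf sf mA.
suff -> : bochner_integral P A f = v by [].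
(* The limit chosen by [get] may come from another sequence [s']; the estimate with [e = 0]
   identifies it with [v]. *)
rewrite /bochner_integral; case: xgetP => [u _ [s' s'f s'u]|/(_ v) []].
- apply/subr0_eq/eqP; rewrite -normr_le0 -[leRHS](mul0r (fine (P A))).
  apply: (bochner_limit_dist mf mf s'f sf mA _ _ s'u sv) => //.
  by move=> w _; rewrite subrr normr0.
- by exists s.
Qed.

Lemma bochner_integral_dist f f' A (e : R) :
  bochner_integrable P f -> bochner_integrable P f' ->
  measurable A -> 0 <= e -> (forall w, A w -> `|f w - f' w| <= e) ->
  `|bochner_integral P A f - bochner_integral P A f'| <= e * fine (P A).
Proof.
move=> [mf [s sf]] [mf' [s' sf']] mA e0 ff'.
by apply: (bochner_limit_dist mf mf' sf sf' mA e0 ff');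
  exact: bochner_integral_cvg.
Qed.

Lemma bochner_integralU f A B : bochner_integrable P f ->
  measurable A -> measurable B -> [disjoint A & B] ->
  bochner_integral P (A `|` B) f = bochner_integral P A f + bochner_integral P B f.
Proof.
move=> [mf [s sf]] mA mB AB.
have sU := bochner_integral_cvg mf sf (measurableU _ _ mA mB).
have sD := cvgD (bochner_integral_cvg mf sf mA) (bochner_integral_cvg mf sf mB).
have sUE : (fun k => simple_integral P (A `|` B) (s k)) =
    (fun k => simple_integral P A (s k) + simple_integral P B (s k)).
  by apply/funext => k; apply: simple_integralU => //; exact: sf.1.
by rewrite sUE in sU; exact: norm_cvg_unique sU (sD _).
Qed.

Lemma simple_function_cst (x : X) : simple_function (fun _ : T => x).
Proof.
split; first by apply: (sub_finite_set _ (finite_set1 x)) => _ [_ _ <-].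
by move=> y; rewrite preimage_cst; case: ifP.
Qed.

Lemma bochner_approx_simple (s : T -> X) : simple_function s -> bochner_approx P s (fun=> s).
Proof.
move=> ss; split=> //.
under eq_fun do under eq_integral do rewrite subrr normr0.
by rewrite integral0; exact: cvg_cst.
Qed.

Lemma bochner_integrable_cst (x : X) : bochner_integrable P (fun=> x).
Proof.
have sx := simple_function_cst x; split; first exact: simple_function_borel.
by exists (fun _ _ => x); exact: bochner_approx_simple.
Qed.

Lemma bochner_integral_cst A (x : X) : measurable A ->
  bochner_integral P A (fun=> x) = fine (P A) *: x.
Proof.
move=> mA; have sx := simple_function_cst x.
have := bochner_integral_cvg (simple_function_borel sx) (bochner_approx_simple sx) mA.
move=> /cvg_lim <-//; rewrite lim_cst//.
(* A constant factors through [unit], so its integral is a sum with a single term. *)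
have f1 : finite_set (range (fun _ : T => tt)) by exact: finite_finset.
rewrite (@simple_integral_comp _ _ _ _ _ _ (fun _ : T => tt) (fun=> x))//.
  rewrite (_ : range _ = [set tt]) ?fsbig_set1 ?preimage_cst ?mem_set// ?setIT//.
  by apply/seteqP; split => [[]//|[] _]; exists point.
by move=> y; rewrite preimage_cst; case: ifP.
Qed.

End BochnerIntegral.

(** * Conditional expectation on an atomic sigma-field *)

Section Fibers.
Context (T : Type).

(** Only attained labels are used, since the members of a partition must be nonempty. *)
Definition fibers (phi : T -> nat) : set (set T) :=
  [set phi @^-1` [set k] | k in range phi].

(** Preimages under [phi] form a sigma-field, and each is a countable union of fibers because the
    labels are natural numbers. *)
Lemma fibers_sigma_algebraE (phi : T -> nat) :
  <<s fibers phi >> = [set phi @^-1` S | S in [set: set nat]].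
Proof.
apply/seteqP; split.
  apply: smallest_sub => [|_ [k _ <-]]; last by exists [set k].
  split; first by exists set0 => //; rewrite preimage_set0.
    by move=> _ [S _ <-]; exists (~` S); rewrite // setTD preimage_setC.
  (* The witness is the set of labels attained on the union, which avoids choosing a set of labels
     for each [F n]. *)
  move=> F FS; exists (\bigcup_n [set k | exists2 w, F n w & phi w = k]) => //.
  apply/seteqP; split => [w [n _ [v Fv vw]]|w [n _ Fw]].
    by exists n => //; have [S _ SF] := FS n; move: Fv; rewrite -SF/= vw.
  by exists n => //; exists w.
move=> _ [S _ <-].
rewrite (_ : _ @^-1` _ = \bigcup_k (if k \in S then phi @^-1` [set k] else set0)).
  have [s0 _ sU] := smallest_sigma_algebra setT (fibers phi).
  apply: sU => k; case: ifP => // _.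
  have [[w _ wk]|nk] := pselect (range phi k).
    by apply: sub_sigma_algebra; exists k => //; exists w.
  rewrite (_ : _ @^-1` _ = set0)//; apply/seteqP; split => // w /= wk.
  by apply: nk; exists w.
apply/seteqP; split => [w Sw|w [k _]].
  by exists (phi w) => //; rewrite mem_set.
by case: ifPn => // /set_mem Sk /= ->.
Qed.

Lemma fibers_partition (phi : T -> nat) : partition (fibers phi) id setT.
Proof.
split.
- apply/seteqP; split => // w _; exists (phi @^-1` [set phi w]) => //.
  by exists (phi w) => //; exists w.
- by move=> _ _ [k _ <-] [l _ <-] [w [/= <- <-]].
- by move=> _ [k [w _ wk] <-]; exists w.
Qed.

Lemma countable_fibers (phi : T -> nat) : countable (fibers phi).
Proof. exact: (sub_countable (card_image_le _ _)). Qed.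

End Fibers.

Lemma finite_range_bounded (T : Type) (R : realType) (X : normedModType R)
  (s : T -> X) : finite_set (range s) -> exists M : R, forall w, `|s w| <= M.
Proof.
move=> fs; exists (\sum_(x \in range s) `|x|) => w.
rewrite (fsbigD1 (s w))//=; last by exists w.
by rewrite lerDl; apply: fsumr_ge0.
Qed.

Section AtomicConditionalExpectation.
Context (d : measure_display) (T : measurableType d) (R : realType).
Context (X : completeNormedModType R) (P : probability T R).
Context (phi : T -> nat).
Context (mphi : forall k, measurable (phi @^-1` [set k])).

Lemma measurable_label (S : set nat) : measurable (phi @^-1` S).
Proof.
rewrite (_ : _ @^-1` _ = \bigcup_(k in S) phi @^-1` [set k]).
  by apply: bigcup_measurable => k _; exact: mphi.
by apply/seteqP; split => [w Sw|w [k Sk /= ->]//]; exists (phi w).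
Qed.

Lemma measurable_fibers_sigma A : <<s fibers phi >> A -> measurable A.
Proof. by rewrite fibers_sigma_algebraE => -[S _ <-]; exact: measurable_label. Qed.

Lemma atomic_fibers : @atomic d T <<s fibers phi >>.
Proof.
exists (fibers phi); split => //; [exact: countable_fibers| |exact: fibers_partition].
by move=> _ [k _ <-]; exact: mphi.
Qed.

(** Points of [X] are closed, so the level set of [g] through [w] is measurable, hence a preimage
    under [phi]; containing [w], it contains [w']. *)
Lemma fibers_measurable_constant (g : T -> X) :
  borel_measurable <<s fibers phi >> g ->
  forall w w', phi w = phi w' -> g w = g w'.
Proof.
move=> mg w w' ww'.
have : <<s @open X >> [set g w].
  rewrite -[X in <<s _ >> X]setCK -setTD.
  have [_ sC _] := smallest_sigma_algebra setT (@open X).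
  apply: sC; apply: sub_sigma_algebra; rewrite openC.
  exact/accessible_closed_set1/hausdorff_accessible/norm_hausdorff.
move=> /mg; rewrite fibers_sigma_algebraE => -[S _ gS].
have : (phi @^-1` S) w by rewrite gS.
by rewrite /preimage/= ww' -[S _]/((phi @^-1` S) w') gS /= => ->.
Qed.

(** Finite additivity gives equality on the part of [S] below [k]. The remaining difference is at
    most [e] times the probability that [phi] is at least [k], which tends to 0. The uniform bound
    thus takes the place of countable additivity. *)
Lemma bochner_integral_fibers_ext (f f' : T -> X) (e : R) (S : set nat) :
  bochner_integrable P f -> bochner_integrable P f' -> 0 <= e ->
  (forall w, `|f w - f' w| <= e) ->
  (forall k, bochner_integral P (phi @^-1` [set k]) f =
             bochner_integral P (phi @^-1` [set k]) f') ->
  bochner_integral P (phi @^-1` S) f = bochner_integral P (phi @^-1` S) f'.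
Proof.
move=> intf intf' e0 ff' atomE.
have int_set0 : bochner_integral P set0 f = bochner_integral P set0 f'.
  apply/subr0_eq/eqP; rewrite -normr_le0 -[leRHS](mul0r (fine (P set0))).
  exact: bochner_integral_dist.
have intU (u : T -> X) S1 S2 : bochner_integrable P u -> S1 `&` S2 = set0 ->
    bochner_integral P (phi @^-1` (S1 `|` S2)) u =
    bochner_integral P (phi @^-1` S1) u + bochner_integral P (phi @^-1` S2) u.
  move=> intu S12; rewrite preimage_setU.
  apply: (bochner_integralU intu (measurable_label _) (measurable_label _)).
  by apply/disj_set2P; rewrite -preimage_setI S12 preimage_set0.
have singletonE k : bochner_integral P (phi @^-1` (S `&` [set k])) f =
    bochner_integral P (phi @^-1` (S `&` [set k])) f'.
  have [Sk|nSk] := pselect (S k).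
    have -> : S `&` [set k] = [set k] by apply/seteqP; split => [_ []//|_ ->].
    exact: atomE.
  have -> : S `&` [set k] = set0.
    by apply/seteqP; split => // n [Sn nk]; apply: nSk; rewrite -nk.
  by rewrite preimage_set0; exact: int_set0.
have head k : bochner_integral P (phi @^-1` (S `&` `I_k)) f =
    bochner_integral P (phi @^-1` (S `&` `I_k)) f'.
  elim: k => [|k IH]; first by rewrite II0 setI0 preimage_set0; exact: int_set0.
  have SIk : (S `&` `I_k) `&` (S `&` [set k]) = set0.
    by apply/seteqP; split => // n [[_ /= nk] [_ nE]]; rewrite nE ltnn in nk.
  by rewrite IIS setIUr (intU _ _ _ intf SIk) (intU _ _ _ intf' SIk) IH singletonE.
have tail k : `|bochner_integral P (phi @^-1` S) f - bochner_integral P (phi @^-1` S) f'|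
    <= e * fine (P (phi @^-1` (~` `I_k))).
  have SE : S = (S `&` `I_k) `|` (S `&` ~` `I_k) by rewrite -setIUr setUv setIT.
  have dj : (S `&` `I_k) `&` (S `&` ~` `I_k) = set0.
    by apply/seteqP; split => // n [[_ nk] [_ nnk]].
  rewrite SE (intU _ _ _ intf dj) (intU _ _ _ intf' dj).
  rewrite head opprD addrACA subrr add0r.
  apply: (le_trans (bochner_integral_dist intf intf' (measurable_label _) e0 _)).
    by move=> w _; exact: ff'.
  apply: ler_wpM2l => //; apply: fine_le.
  - by apply: fin_num_measure; exact: measurable_label.
  - by apply: fin_num_measure; exact: measurable_label.
  - by apply: le_measure; [apply/mem_set; exact: measurable_label..|move=> w []].
apply/subr0_eq/eqP; rewrite -normr_le0.
have P0 : P (phi @^-1` (~` `I_k)) @[k --> \oo] --> 0%E.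
  rewrite -(measure0 P) (_ : set0 = \bigcap_k phi @^-1` (~` `I_k)).
    apply: nonincreasing_cvg_mu.
    - by rewrite ltey_eq fin_num_measure//; exact: measurable_label.
    - by move=> k; exact: measurable_label.
    - by apply: bigcap_measurable => // k _; exact: measurable_label.
    - move=> k l kl; apply/subsetPset => w /= nwl wk; apply: nwl.
      exact: leq_trans kl.
  apply/seteqP; split => // w /(_ (phi w).+1 Logic.I) /=; apply; exact: ltnSn.
have /fine_cvgP[_ eP0] := P0.
rewrite -[leRHS](mulr0 e).
apply: (cvgr_to_ge (F := \oo) (f := fun k => e * fine (P (phi @^-1` (~` `I_k))))).
  by apply: cvgM; [exact: cvg_cst|exact: eP0].
exact: nearW.
Qed.

Context (h : T -> X) (e : R).
Context (inth : bochner_integrable P h) (e0 : 0 <= e).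
Context (osc : forall w w', phi w = phi w' -> `|h w - h w'| <= e).

Let A k := phi @^-1` [set k].

Lemma bochner_integral_atom w :
  `|bochner_integral P (A (phi w)) h - fine (P (A (phi w))) *: h w|
    <= e * fine (P (A (phi w))).
Proof.
rewrite -bochner_integral_cst; last exact: mphi.
apply: bochner_integral_dist => //; first exact: bochner_integrable_cst.
  exact: mphi.
by move=> v /= vw; exact: osc.
Qed.

(** On an atom [g] is constant and has the same integral as [h], so on an atom of positive
    probability it is the average of [h]. The exceptional set lies in the countable union of the
    null atoms. *)
Lemma condexp_fibers_dist g :
  is_condexp P <<s fibers phi >> h g -> {ae P, forall w, `|h w - g w| <= e}.
Proof.
move=> [mg ig gh].
apply: (@negligibleS _ _ _ _ (\bigcup_k if P (A k) == 0%E then A k else set0)); last first.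
  apply: negligible_bigcup => k; case: eqP => [Ak0|_]; last exact: negligible_set0.
  by apply/negligibleP => //; exact: mphi.
move=> w /= hg; exists (phi w) => //; case: eqP => // /eqP Pw0; apply: hg.
have p0 : 0 < fine (P (A (phi w))).
  by apply: fine_gt0; rewrite lt0e Pw0 measure_ge0 ltey_eq fin_num_measure//; exact: mphi.
(* After multiplication by the probability of the atom, the claim compares integrals over the
   atom. *)
rewrite -(ler_pM2r p0) distrC; apply: le_trans (bochner_integral_atom w).
rewrite -gh; last by rewrite fibers_sigma_algebraE; exists [set phi w].
have -> : bochner_integral P (A (phi w)) g = fine (P (A (phi w))) *: g w.
  apply/subr0_eq/eqP; rewrite -normr_le0 -bochner_integral_cst; last exact: mphi.
  rewrite -[leRHS](mul0r (fine (P (A (phi w))))); apply: bochner_integral_dist => //.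
  - exact: bochner_integrable_cst.
  - exact: mphi.
  - move=> v /= vw; rewrite (fibers_measurable_constant mg vw) subrr normr0//.
by rewrite -scalerBr normrZ gtr0_norm// mulrC.
Qed.

Let p k := fine (P (A k)).

(* The average of h over the atom of w; on null atoms, some value of h on the
   atom, so that |h - g| <= e everywhere. *)
Let g w := if p (phi w) == 0 then get (h @` A (phi w))
  else (p (phi w))^-1 *: bochner_integral P (A (phi w)) h.

Let p_ge0 k : 0 <= p k.
Proof. exact: fine_ge0. Qed.

Let g_phi w w' : phi w = phi w' -> g w = g w'.
Proof. by rewrite /g => ->. Qed.

Let h_sub_g w : `|h w - g w| <= e.
Proof.
rewrite /g; case: eqVneq => [_|pn0].
  by case: xgetP => [_ -> [w' + <-]|/(_ (h w))[]]; [move=> /esym; exact: osc|exists w].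
have p0 : 0 < p (phi w) by rewrite lt_neqAle eq_sym pn0 p_ge0.
rewrite -[h w](scalerK pn0) -scalerBr normrZ gtr0_norm ?invr_gt0//.
by rewrite ler_pdivrMl// distrC mulrC; exact: bochner_integral_atom.
Qed.

Let g_preimage (B : set X) : <<s fibers phi >> (g @^-1` B).
Proof.
rewrite fibers_sigma_algebraE; exists (phi @` (g @^-1` B)) => //.
apply/seteqP; split => [w [v /= + vw]|w gw]; last by exists w.
by rewrite (g_phi vw).
Qed.

Let measurable_fun_label (u : T -> \bar R) :
  (forall w w', phi w = phi w' -> u w = u w') -> measurable_fun setT u.
Proof.
move=> uphi _ B mB; rewrite setTI.
rewrite (_ : _ @^-1` _ = phi @^-1` (phi @` (u @^-1` B))).
  exact: measurable_label.
apply/seteqP; split => [w uw|w [v /= + vw]]; first by exists w.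
by rewrite (uphi _ _ vw).
Qed.

(** The norm of [g] is at most [|h - s j| + e + M], where [s j] is a simple function at finite mean
    distance from [h] and [M] bounds its norm. *)
Let integrable_norm_g : P.-integrable setT (fun w => (`|g w|)%:E).
Proof.
apply/integrableP; split; first by apply: measurable_fun_label => w w' /g_phi ->.
under eq_integral do rewrite abse_EFin normr_id.
have [mh [s [ss s0]]] := inth.
have /fine_cvgP[[j _ sfin] _] := s0.
have {}sfin := sfin j (leqnn j).
have [M sM] := finite_range_bounded (ss j).1.
apply: (@le_lt_trans _ _ (\int[P]_w ((`|h w - s j w|)%:E + cst (e + M)%:E w))%E).
  apply: ge0_le_integral => //.
  - by apply: measurable_fun_label => w w' /g_phi ->.
  - by apply: emeasurable_funD => //; exact: measurable_norm_sub.
  - move=> w _; rewrite -EFinD lee_fin.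
    have -> : g w = - (h w - g w) + (h w - s j w) + s j w.
      by rewrite opprB addrA !subrK.
    apply: le_trans (ler_normD _ _) _.
    apply: le_trans (lerD (ler_normD _ _) (sM w)) _.
    by rewrite normrN [leRHS]addrA (addrC _ e) !lerD2r; exact: h_sub_g.
rewrite ge0_integralD//.
- apply: lte_add_pinfty; first by rewrite ltey_eq; apply/orP; left; exact: sfin.
  by rewrite integral_cst// [X in (_ * X)%E](probability_setT P) mule1 ltry.
- exact: measurable_norm_sub.
- move=> w _; rewrite lee_fin addr_ge0//; exact: le_trans (normr_ge0 _) (sM w).
Qed.

(** Truncation to the labels below [k]: [g] may take infinitely many values, [gk k] takes finitely
    many. *)
Let gk k w := if (phi w < k)%N then g w else 0.

Let gk_simple k : simple_function (gk k).
Proof.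
have gkphi w w' : phi w = phi w' -> gk k w = gk k w'.
  by rewrite /gk => ww'; rewrite ww' (g_phi ww').
split; last first.
  move=> x; rewrite (_ : _ @^-1` _ = phi @^-1` (phi @` (gk k @^-1` [set x]))).
    exact: measurable_label.
  apply/seteqP; split => [w uw|w [v /= + vw]]; first by exists w.
  by rewrite (gkphi _ _ vw).
(* The values lie among 0 and one value per label below [k]; [get] returns that value, as [gk k] is
   constant on each atom. *)
apply: (@sub_finite_set _ _ ((fun n => get (gk k @` A n)) @` `I_k `|` [set 0])).
  move=> _ [w _ <-]; have [wk|wk] := ltnP (phi w) k; last first.
    by right; rewrite /gk ltnNge wk.
  left; exists (phi w) => //; case: xgetP => [_ -> [v vw <-]|/(_ (gk k w))[]].
    exact: gkphi.
  by exists w.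
by rewrite finite_setU; split; [exact/finite_image/finite_II|exact: finite_set1].
Qed.

(** Dominated convergence: [|g - gk k|] is bounded by [|g|], and at each [w] it vanishes as soon as
    [k] exceeds [phi w]. *)
Let integrable_g : bochner_integrable P g.
Proof.
split; first by move=> B _; apply: measurable_fibers_sigma; exact: g_preimage.
exists gk; split => //.
have dphi k w w' : phi w = phi w' -> `|g w - gk k w|%:E = `|g w' - gk k w'|%:E.
  by rewrite /gk => ww'; rewrite ww' (g_phi ww').
have [] := @dominated_convergence _ _ _ P setT measurableT
  (fun k w => (`|g w - gk k w|)%:E) (cst 0%E) (fun w => (`|g w|)%:E).
- by move=> k; apply: measurable_fun_label => w w'; exact: dphi.
- exact: measurable_cst.
- apply: aeW => w _; apply: cvg_near_cst; exists (phi w).+1 => //= k wk.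
  by rewrite /gk wk subrr normr0.
- exact: integrable_norm_g.
- apply: aeW => w k _; rewrite abse_EFin normr_id lee_fin /gk.
  by case: ifP; rewrite ?subrr ?subr0 ?normr0.
- by rewrite integral0.
Qed.

Let bochner_integral_g_atom k :
  bochner_integral P (A k) g = bochner_integral P (A k) h.
Proof.
apply/subr0_eq/eqP; rewrite -normr_le0.
(* On a null atom the bound [|h - g| <= e] makes the two integrals differ by at most [e * 0];
   otherwise [g] is the average of [h] there. *)
have [pk0|pn0] := eqVneq (p k) 0.
  rewrite -[leRHS](mulr0 e) -pk0; apply: bochner_integral_dist => //; first exact: mphi.
  by move=> w _; rewrite distrC.
have [Ak0|/set0P[w wk]] := eqVneq (A k) set0.
  by case/eqP: pn0; rewrite /p Ak0 measure0.
rewrite -[bochner_integral P _ h](scalerKV pn0).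
have -> : (p k)^-1 *: bochner_integral P (A k) h = g w.
  by rewrite /g wk (negbTE pn0).
rewrite -bochner_integral_cst; last exact: mphi.
rewrite -[leRHS](mul0r (p k)).
apply: (bochner_integral_dist integrable_g (bochner_integrable_cst P (g w))
  (mphi k) (lexx 0)).
by move=> v vk; rewrite (@g_phi v w) ?subrr ?normr0// wk.
Qed.

Lemma condexp_fibers_exists :
  exists g, is_condexp P <<s fibers phi >> h g.
Proof.
exists g; split; [by move=> B _; exact: g_preimage|exact: integrable_g|].
rewrite fibers_sigma_algebraE => _ [S _ <-].
apply: (bochner_integral_fibers_ext S integrable_g inth e0) => [w|k].
  by rewrite distrC.
exact: bochner_integral_g_atom.
Qed.

End AtomicConditionalExpectation.

(** * Refinement of labels, labels on a separable space, and the construction of the filtration *)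

Lemma fibers_sigma_sub (T : Type) (phi psi : T -> nat) :
  (forall w w', psi w = psi w' -> phi w = phi w') ->
  <<s fibers phi >> `<=` <<s fibers psi >>.
Proof.
move=> psiphi; rewrite !fibers_sigma_algebraE => _ [S _ <-].
exists (psi @` (phi @^-1` S)) => //.
apply/seteqP; split => [w [v /= + vw]|w Sw]; last by exists w.
by rewrite (psiphi _ _ vw).
Qed.

(** Balls of radius [e / 2] around a countable dense set cover [X]; [kappa x] is the index of the
    first ball that contains [x]. *)
Lemma separable_label (R : realType) (X : normedModType R) (e : R) :
  separable X -> 0 < e ->
  exists kappa : X -> nat, (forall k, <<s @open X >> (kappa @^-1` [set k])) /\
    forall x y, kappa x = kappa y -> `|x - y| <= e.
Proof.
move=> [D [/countable_injP[c cinj] denseD]] e0.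
(* As [c] is injective on [D], each [B n] is a single ball or empty, so finite and infinite [D] are
   treated alike. *)
pose B n := \bigcup_(y in D `&` c @^-1` [set n]) ball y (e / 2).
have Bopen n : open (B n) by apply: bigcup_open => y _; exact: ball_open.
have Bcover x : exists n, B n x /\ forall m, (m < n)%N -> ~ B m x.
  have e20 : 0 < e / 2 by rewrite divr_gt0.
  have [|y [xy Dy]] := denseD (ball x (e / 2)) _ (@ball_open _ _ _ _).
    by exists x; exact: ballxx.
  have Bx : exists n, `[< B n x >].
    by exists (c y); apply/asboolP; exists y => //; exact: ball_sym.
  exists (ex_minn Bx); case: ex_minnP => n /asboolP Bn nmin; split => // m mn.
  by move=> /asboolP /nmin; rewrite leqNgt mn.
have [kappa kappaP] := choice Bcover; exists kappa; split => [k|x y xy].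
  rewrite (_ : _ @^-1` _ = B k `\` \bigcup_(m in `I_k) B m).
    have mB m : (@open X).-sigma.-measurable (B m) by exact: sub_sigma_algebra.
    apply: (@measurableD _ (g_sigma_algebraType (@open X))); first exact: mB.
    by apply: bigcup_measurable => m _; exact: mB.
  apply/seteqP; split => x.
    move=> /= <-; have [Bx Bmin] := kappaP x; split => // -[m mx]; exact: Bmin.
  move=> [Bx nB]; have [Bx' Bmin] := kappaP x; apply/eqP.
  rewrite eqn_leq leqNgt [X in _ && X]leqNgt; apply/andP; split; apply/negP.
    by move=> /Bmin.
  by move=> kx; apply: nB; exists (kappa x).
have [[u [Du cu] xu] _] := kappaP x; have [[v [Dv cv] yv] _] := kappaP y.
(* Equal labels give equal centers, by injectivity of [c]. *)
have uv : u = v.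
  by apply: cinj; rewrite ?inE// cu cv xy.
rewrite -uv in yv; apply/ltW.
move: xu yv; rewrite -ball_normE /ball_/= => xu yv.
rewrite (_ : x - y = (u - y) - (u - x)); last by rewrite opprB [RHS]addrC addrA subrK.
by rewrite [e]splitr; apply: le_lt_trans (ler_normB _ _) _; exact: ltrD.
Qed.

Theorem proposition1p1 (R : realType) (X : completeNormedModType R)
    (hX : separable X)
    (d : measure_display) (T : measurableType d) (P : probability T R)
    (N : nat) (F : 'I_N.+1 -> set (set T)) (hF : filtration F)
    (f : 'I_N.+1 -> T -> X) (hf : martingale P F f)
    (eps : R) (heps : 0 < eps) :
  exists G : 'I_N.+1 -> set (set T),
    filtration G /\
    forall n : 'I_N.+1,
      [/\ atomic (G n),
          G n `<=` F n,
          (exists g : T -> X, is_condexp P (G n) (f ord_max) g) &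
          forall g : T -> X, is_condexp P (G n) (f ord_max) g ->
            {ae P, forall w, `|f n w - g w| < eps}].
Proof.
have [Fsub Fmono] := hF; have [intf condf] := hf.
(* The oscillation bound is a weak inequality; halving [eps] makes the final one strict. *)
have eps20 : 0 < eps / 2 by rewrite divr_gt0.
have [kappa [mkappa kappaP]] := separable_label hX eps20.
have versions n : exists hn, is_condexp P (F n) (f ord_max) hn /\
    {ae P, forall w, hn w = f n w}.
  by have [hn] := condf n ord_max (leq_ord n); exists hn.
have [h hP] := choice versions.
(* Padding with 0 beyond [n] puts the labels for all times in one countable type, which [pickle]
   then encodes in [nat]. *)
pose lab (n : 'I_N.+1) w : {ffun 'I_N.+1 -> nat} :=
  [ffun i : 'I_N.+1 => if (i <= n)%N then kappa (h i w) else 0%N].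
pose phi n w := pickle (lab n w).
have phiP n w w' : phi n w = phi n w' <->
    forall i : 'I_N.+1, (i <= n)%N -> kappa (h i w) = kappa (h i w').
  split => [/(pcan_inj pickleK)/ffunP lE i lein|lE].
    by have := lE i; rewrite !ffunE lein.
  by congr pickle; apply/ffunP => i; rewrite !ffunE; case: ifP => // /lE.
have phiF n k : F n (phi n @^-1` [set k]).
  have FE := sigma_algebra_id (Fsub n).1.
  have [[w wk]|nk] := pselect (exists w, phi n w = k); last first.
    rewrite (_ : _ @^-1` _ = set0); first by have [[F0 _ _] _] := Fsub n.
    by apply/seteqP; split => // w /= wk; apply: nk; exists w.
  (* An attained fiber is a finite intersection of events, the one for time [i] lying in [F i],
     hence in [F n]. *)
  rewrite (_ : _ @^-1` _ = \bigcap_(i in [set i : 'I_N.+1 | (i <= n)%N])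
      (h i @^-1` (kappa @^-1` [set kappa (h i w)]))).
    rewrite -FE; apply: (@fin_bigcap_measurable _ (g_sigma_algebraType (F n))) => //.
    move=> i /= lein; rewrite /measurable/= FE; apply: (Fmono _ _ lein).
    by have [[mh _ _] _] := hP i; exact: mh.
  apply/seteqP; split => v.
    by move=> /= vk i lein; apply: ((phiP n v w).1 _ i lein); rewrite vk wk.
  by move=> vw; rewrite /= -wk; apply/phiP => i lein; exact: (vw i lein).
have mphi n k : measurable (phi n @^-1` [set k]) by exact: (Fsub n).2.
have GF n : <<s fibers (phi n) >> `<=` F n.
  apply: smallest_sub; first exact: (Fsub n).1.
  by move=> _ [k _ <-]; exact: phiF.
exists (fun n => <<s fibers (phi n) >>); split.
  split=> [n|n m nm].
    split; first exact: smallest_sigma_algebra.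
    exact: subset_trans (GF n) (Fsub n).2.
  apply: fibers_sigma_sub => w w' /phiP mE; apply/phiP => i lein.
  by apply: mE; exact: leq_trans nm.
move=> n; have [[mh inth hE] hf_ae] := hP n.
have osc w w' : phi n w = phi n w' -> `|h n w - h n w'| <= eps / 2.
  by move=> /phiP wE; apply: kappaP; exact: wE.
split => //.
- exact: atomic_fibers.
- have [g [mg ig gh]] := condexp_fibers_exists (mphi n) inth (ltW eps20) osc.
  (* Tower property: [h n] and [f ord_max] have equal integrals over the sets of [F n], hence over
     those of the smaller field, so they share their conditional expectations. *)
  by exists g; split => // A GA; rewrite gh// hE//; exact: GF.
- move=> g [mg ig gh].
  have hg : is_condexp P <<s fibers (phi n) >> (h n) g.
    by split => // A GA; rewrite gh// hE//; exact: GF.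
  have := condexp_fibers_dist (mphi n) inth (ltW eps20) osc hg.
  apply: filterS2 hf_ae => w -> /le_lt_trans; apply.
  by rewrite ltr_pdivrMr// ltr_pMr// ltr1n.
Qed.
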